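(* Let $\mathbf{C}$ be one of the following classes: the class of all cones, the class of all cancellative cones, or the class of all separative cones. Then every simply $\mathbf{C}$-unitarily closed element of $\mathbf{C}$ is a normally divisible refinement cone.
   Context: Commutative monoids are written additively. The algebraic preordering of a commutative monoid $M$ is $x\le y\iff(\exists z\in M)(x+z=y)$. A cone is a commutative monoid that is conical: $x+y=0\Rightarrow x=y=0$. It is cancellative if $x+z=y+z\Rightarrow x=y$, and separative if $2x=x+y=2y\Rightarrow x=y$. An order-unit of $M$ is $u\in M$ such that every $x\in M$ satisfies $x\le nu$ for some positive integer $n$. $M$ is simple if every $u\in M$ with $u\not\le 0$ is an order-unit of $M$. A refinement cone is a cone with the refinement property: whenever $a_0+a_1=b_0+b_1$ there are $c_{ij}$ ($i,j<2$) with $a_i=c_{i0}+c_{i1}$ and $b_i=c_{0i}+c_{1i}$ for all $i<2$. A commutative monoid $M$ is normally divisible if for every positive integer $p$, every finite subset $X\subseteq M$ and every $a\in M$, there is $u\in M$ with $pu=a$ and, for all $x,y\in X$, $x+a=y+a\Rightarrow x+u=y+u$. If $A$ is a submonoid of a commutative monoid $B$, then $B$ is a unitary extension of $A$ if $A$ is cofinal in $B$ (every $b\in B$ satisfies $b\le a$ in $B$ for some $a\in A$), and for all $a_0,a_1\in A$ and $b\in B$, $a_0+b=a_1$ implies $b\in A$. An equation system with parameters from $M$ is a finite set of equations, each of the form $\sum_{i<k}p_i\mathbf{x}_i+a=\sum_{i<k}q_i\mathbf{x}_i+b$ with $k,p_i,q_i$ non-negative integers, $a,b\in M$, and $\mathbf{x}_i$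 unknowns. A simple element $M$ of $\mathbf{C}$ is simply $\mathbf{C}$-unitarily closed if every equation system with parameters from $M$ that has a solution in some unitary extension of $M$ that is simple and belongs to $\mathbf{C}$ has a solution in $M$. *)

(* Defs.v *)
From HB Require Import structures.
From mathcomp Require Import all_boot all_algebra.

Set Implicit Arguments.
Unset Strict Implicit.
Unset Printing Implicit Defensive.

Import GRing.Theory.
Local Open Scope ring_scope.

(* Commutative monoids, written additively, are the [nmodType]s. The choice
   operator that [nmodType] carries on top of the monoid structure is no
   restriction classically. *)

Definition alg_le (M : nmodType) (x y : M) : Prop := exists z : M, x + z = y.

Definition conical (M : nmodType) : Prop :=
  forall x y : M, x + y = 0 -> x = 0 /\ y = 0.

Definition cancellative (M : nmodType) : Prop :=
  forall x y z : M, x + z = y + z -> x = y.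

Definition separative (M : nmodType) : Prop :=
  forall x y : M, x *+ 2 = x + y -> x + y = y *+ 2 -> x = y.

Definition cone (M : nmodType) : Prop := conical M.

Definition cancellative_cone (M : nmodType) : Prop := cone M /\ cancellative M.

Definition separative_cone (M : nmodType) : Prop := cone M /\ separative M.

Definition order_unit (M : nmodType) (u : M) : Prop :=
  forall x : M, exists n : nat, (0 < n)%N /\ alg_le x (u *+ n).

Definition simple_monoid (M : nmodType) : Prop :=
  forall u : M, ~ alg_le u 0 -> order_unit u.

Definition refinement_property (M : nmodType) : Prop :=
  forall a b : 'I_2 -> M, a 0 + a 1 = b 0 + b 1 ->
  exists c : 'I_2 -> 'I_2 -> M,
    forall i : 'I_2, a i = c i 0 + c i 1 /\ b i = c 0 i + c 1 i.

Definition refinement_cone (M : nmodType) : Prop :=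
  cone M /\ refinement_property M.

Definition normally_divisible (M : nmodType) : Prop :=
  forall (p : nat) (X : seq M) (a : M), (0 < p)%N ->
  exists u : M, u *+ p = a /\
    forall x y : M, x \in X -> y \in X -> x + a = y + a -> x + u = y + u.

(* The inclusion of a submonoid A in B is represented by an injective monoid
   homomorphism. *)
Definition unitary_extension (A B : nmodType) (f : {additive A -> B}) : Prop :=
  [/\ injective f,
      forall b : B, exists a : A, alg_le b (f a)
    & forall (a0 a1 : A) (b : B), f a0 + b = f a1 -> exists a : A, b = f a].

(* The number of unknowns may vary from one equation to the next; the unknowns
   themselves are indexed by [nat] and shared by all equations of a system. *)
Record equation (M : Type) : Type := Equation {
  eqn_k : nat;
  eqn_p : 'I_eqn_k -> nat;
  eqn_q : 'I_eqn_k -> nat;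
  eqn_a : M;
  eqn_b : M
}.

(* [f] carries the parameters into the monoid where the unknowns live. *)
Definition eqn_holds (M : Type) (N : nmodType) (f : M -> N) (x : nat -> N)
    (e : equation M) : Prop :=
  \sum_(i < eqn_k e) x i *+ eqn_p i + f (eqn_a e) =
  \sum_(i < eqn_k e) x i *+ eqn_q i + f (eqn_b e).

Definition solvable_in (M : Type) (N : nmodType) (f : M -> N)
    (n : nat) (S : 'I_n -> equation M) : Prop :=
  exists x : nat -> N, forall j : 'I_n, eqn_holds f x (S j).

Definition simply_unitarily_closed (C : nmodType -> Prop) (M : nmodType) :
    Prop :=
  [/\ C M, simple_monoid M
    & forall (n : nat) (S : 'I_n -> equation M),
        (exists (N : nmodType) (f : {additive M -> N}),
           [/\ C N, simple_monoid N, unitary_extension f & solvable_in f S]) ->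
        solvable_in idfun S].

(* Main.v *)
(* Every extension used here is a syntactic quotient. Let K be a commutative
   monoid with a partial homomorphism to M, defined on a submonoid D of K such
   that d, d + k in D imply k in D, and surjective onto M. Identifying k and k'
   whenever k + g and k' + g have the same value in M, or both have none, for
   every g in K, gives a unitary extension of M. When M is simple it inherits
   cancellativity from M, and also separativity, because nonzero elements of a
   simple separative cone cancel. It is simple as soon as a multiple of each
   nonzero k lies above some element of D with nonzero value.

   - Division of a by p: K = M x nat, where (x, q p) has value x + q a. If
     x + a = y + a, then x + u and y + u are identified automatically.
   - Two nonzero elements a, b have a common nonzero lower bound d: write
     n b = a + w and adjoin d, e with n d = a, n e = w, d + e = b.
   - Refinement of a0 + a1 = b0 + b1, all nonzero: take a nonzero d below the
     four terms and 5 v = d with the cancellation clause of normal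
     divisibility. This gives a_i = al_i + 2 v and b_j = be_j + 2 v with
     al0 + al1 = be0 + be1. Adjoin c'_ij refining the latter equation, but keep
     only those sums of c'_ij that lie in M or come with a summand v. Then
     twice any sum outside M is above v, so the extension is simple, and
     c_ij = c'_ij + v refine the original equation. *)
Require Import Defs.
From HB Require Import structures.
From mathcomp Require Import all_boot all_algebra.
From mathcomp Require Import boolp.
From mathcomp Require Import zify.

Set Implicit Arguments.
Unset Strict Implicit.
Unset Printing Implicit Defensive.

Import GRing.Theory.
Local Open Scope ring_scope.
Local Open Scope quotient_scope.

(** * Quotients of commutative monoids by congruences *)

Section CongruenceQuotient.

Variables (K : nmodType) (E : K -> K -> Prop).
Hypotheses (E_refl : forall x, E x x) (E_sym : forall x y, E x y -> E y x)
  (E_trans : forall x y z, E x y -> E y z -> E x z)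
  (E_add : forall x y z, E x y -> E (x + z) (y + z)).

Let e : rel K := fun x y => `[< E x y >].

Let e_equiv : equiv_class_of e.
Proof.
split=> [x|x y|y x z].
- exact/asboolP.
- by apply/asboolP/asboolP; apply: E_sym.
- by move=> /asboolP xy /asboolP yz; apply/asboolP; apply: E_trans yz.
Qed.

Let e_rel : equiv_rel K := EquivRelPack e_equiv.
Let Q := {eq_quot e_rel}.

Let piP (x y : K) : \pi_Q x = \pi_Q y <-> E x y.
Proof.
split=> [/eqmodP/asboolP //|xy].
by apply/eqmodP/asboolP.
Qed.

Let addq_spec : {addq : Q -> Q -> Q |
  forall x y, addq (\pi_Q x) (\pi_Q y) = \pi_Q (x + y)}.
Proof.
exists (fun a b => \pi_Q (repr a + repr b)) => x y.
have reprE z : E (repr (\pi_Q z)) z by apply/piP; rewrite reprK.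
apply/piP; apply: E_trans (E_add _ (reprE x)) _.
by rewrite ![x + _]addrC; apply: E_add.
Qed.

Let addq : Q -> Q -> Q := sval addq_spec.
Let pi_add : forall x y, addq (\pi_Q x) (\pi_Q y) = \pi_Q (x + y) :=
  svalP addq_spec.

Let addqA : associative addq.
Proof. by do 3!elim/quotW=> ?; rewrite !pi_add addrA. Qed.

Let addqC : commutative addq.
Proof. by do 2!elim/quotW=> ?; rewrite !pi_add addrC. Qed.

Let add0q : left_id (\pi_Q 0) addq.
Proof. by elim/quotW=> ?; rewrite pi_add add0r. Qed.

HB.instance Definition _ := Choice.on Q.
HB.instance Definition _ := GRing.isNmodule.Build Q addqA addqC add0q.

Let pi : K -> Q := fun x => \pi_Q x.

Let pi_morph : nmod_morphism pi.
Proof. by split=> // x y; rewrite /pi -pi_add. Qed.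

HB.instance Definition _ := GRing.isNmodMorphism.Build K Q pi pi_morph.

Lemma congruence_quotient :
  exists (N : nmodType) (p : {additive K -> N}),
    (forall y, exists x, y = p x) /\ (forall x y, p x = p y <-> E x y).
Proof.
exists Q, pi; split=> [y|]; last exact: piP.
by exists (repr y); rewrite /= /pi reprK.
Qed.

End CongruenceQuotient.

(** * Conical, simple and separative monoids *)

Lemma mulrn_eq0_elt (M : nmodType) (x : M) (n : nat) :
  conical M -> (0 < n)%N -> x *+ n = 0 -> x = 0.
Proof. by move=> cM; case: n => // n _; rewrite mulrS => /cM[]. Qed.

Lemma mulrn_eq0_nat (M : nmodType) (cM : conical M) (x : M) (n : nat) :
  x <> 0 -> x *+ n = 0 -> n = 0%N.
Proof. by move=> x0; case: n => // n /(mulrn_eq0_elt cM (ltn0Sn _)). Qed.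

Lemma order_unit_neq0 (M : nmodType) (u : M) :
  conical M -> simple_monoid M -> u <> 0 -> order_unit u.
Proof. by move=> cM sM u0; apply: sM => -[z /cM[]]. Qed.

Definition cancels_neq0 (M : nmodType) : Prop :=
  forall x y z : M, x <> 0 -> y <> 0 -> x + z = y + z -> x = y.

(** One summand [x] is removed at a time. For [X] the smaller multiple, separativity applies to
    [X + x] and [X + y]: since [X] itself contains an [x], the hypothesis turns both doubles into
    their sum. *)
Lemma separative_absorb (M : nmodType) (x y : M) (n : nat) : separative M ->
  x *+ n.+1 + x = x *+ n.+1 + y -> x + x = x + y.
Proof.
move=> sM; elim: n => [|n IHn] H; first by move: H; rewrite mulr1n.
apply: IHn; rewrite mulrSr in H; set X := x *+ n.+1 in H *.
have Hst : (X + x) + (X + y) = (X + x) *+ 2.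
  by rewrite mulr2n [RHS]addrCA H addrCA.
apply: sM; rewrite Hst // -Hst mulr2n.
have HX : X = x *+ n + x by rewrite /X mulrSr.
rewrite [X in X + x]HX [LHS](AC (3*2) ((1*5)*(4*2*3))) /= H.
by rewrite [X in _ = _ + (X + y)]HX [RHS](AC (2*3) ((3*2)*(1*4*5))).
Qed.

(** As [z] lies below a multiple of [x], it can be enlarged to that multiple, and
    [separative_absorb] gives 2x = x + y; symmetrically for [y]. *)
Lemma separative_cancels (M : nmodType) :
  conical M -> simple_monoid M -> separative M -> cancels_neq0 M.
Proof.
move=> cM sM sepM.
have half (x y z : M) : x <> 0 -> x + z = y + z -> x + x = x + y.
  move=> x0 xyz; have [[|n] [// _ [t zt]]] := order_unit_neq0 cM sM x0 z.
  apply: (@separative_absorb _ _ _ n) => //.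
  by rewrite -zt [LHS]addrC [RHS]addrC !addrA xyz.
move=> x y z x0 y0 xyz; apply: sepM; rewrite mulr2n ?(half x y z) //.
by rewrite (half y x z) // addrC.
Qed.

(** * Properties inherited by unitary extensions *)

Section Extension.

Variables (M N : nmodType) (f : {additive M -> N}).
Hypothesis cN : conical N.
Hypothesis uf : unitary_extension f.
Hypothesis sepf : forall x y : N,
  (forall z m, x + z = f m <-> y + z = f m) -> x = y.

Let finj : injective f. Proof. by case: uf. Qed.

Let f_neq0 m : f m <> 0 -> m <> 0.
Proof. by move=> fm m0; apply: fm; rewrite m0 raddf0. Qed.

(** Enlarge [z] to some [f mu]: if [x + w] is in the image of [M], unitarity puts [y + w] there too,
    and [mu] cancels in [M]. Then [sepf] concludes. *)
Lemma extension_cancellative : cancellative M -> cancellative N.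
Proof.
case: uf => _ cof unit canM.
have half (x y z w : N) m : x + z = y + z -> x + w = f m -> y + w = f m.
  move=> xyz xw; have [mu [z' zz']] := cof z.
  have E : f mu + (y + w) = f (mu + m).
    rewrite raddfD -zz' -xw [LHS](AC (2*2) ((3*1)*(4*2))).
    by rewrite [RHS](AC (2*2) ((3*1)*(4*2))) /= xyz.
  have [m' ym'] := unit _ _ _ E; rewrite ym'; congr (f _).
  apply: (canM _ _ mu); apply: finj.
  by rewrite ![_ + mu]addrC -E ym' raddfD.
by move=> x y z xyz; apply: sepf => w m; split; apply: half; eauto.
Qed.

(** Same argument with [x] itself enlarged to [f mu]; the elements left after cancelling [mu] are
    nonzero because [x] and [y] are. *)
Lemma extension_separative : cancels_neq0 M -> separative N.
Proof.
case: uf => _ cof unit canM.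
have half (x y w : N) m : x <> 0 -> y <> 0 -> x + x = x + y ->
    x + w = f m -> y + w = f m.
  move=> x0 y0 xy xw; have [mu [z' xz']] := cof x.
  have E : f mu + (y + w) = f (mu + m).
    rewrite raddfD -xz' -xw [LHS](AC (2*2) ((1*3)*(4*2))).
    by rewrite [RHS](AC (2*2) ((1*3)*(4*2))) /= xy.
  have [m' ym'] := unit _ _ _ E; rewrite ym'; congr (f _).
  apply: (canM _ _ mu).
  - by apply: f_neq0; rewrite -ym' => /cN[].
  - by apply: f_neq0; rewrite -xw => /cN[].
  - by apply: finj; rewrite ![_ + mu]addrC -E ym' raddfD.
move=> x y xx yy; rewrite !mulr2n in xx yy.
have [x0|/eqP x0] := eqVneq x 0.
  by move: yy; rewrite -xx x0 addr0 => /esym/cN[].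
have [y0|/eqP y0] := eqVneq y 0.
  by move: xx; rewrite yy y0 addr0 => /cN[].
apply: sepf => z m; split; apply: half => //.
by rewrite -yy addrC.
Qed.

End Extension.

(* [rep] is the graph of a homomorphism to [M] defined on a submonoid of [K];
   [iota] need not be additive, since only its values modulo the congruence
   [rep_cong] matter. *)
Record representation (M K : nmodType) (iota : M -> K)
    (rep : K -> M -> Prop) : Prop := Representation {
  rep_iota : forall m, rep (iota m) m;
  rep_add : forall k k' m m', rep k m -> rep k' m' -> rep (k + k') (m + m');
  rep_fun : forall k m m', rep k m -> rep k m' -> m = m';
  rep_unitary : forall k k' m m',
    rep k m -> rep (k + k') m' -> exists m'', rep k' m'';
  rep_conical : forall k k', rep (k + k') 0 -> k = 0 /\ k' = 0;
  rep_cofinal : forall k, exists k' m, rep (k + k') m;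
  rep_unit : forall k, k <> 0 -> exists n k0 k1 m,
    [/\ (0 < n)%N, k *+ n = k0 + k1, rep k0 m & m <> 0]
}.

Definition rep_cong (M K : nmodType) (rep : K -> M -> Prop) (k k' : K) : Prop :=
  forall g m, rep (k + g) m <-> rep (k' + g) m.

(** Reduces each construction to a [representation]; the last two clauses serve to verify equations
    in [N]. *)
Lemma representation_extension (C : nmodType -> Prop)
    (hC : C = cone \/ C = cancellative_cone \/ C = separative_cone)
    (M : nmodType) (CM : C M) (sM : simple_monoid M)
    (K : nmodType) (iota : M -> K) (rep : K -> M -> Prop) :
  representation iota rep ->
  exists (N : nmodType) (f : {additive M -> N}) (p : {additive K -> N}),
    [/\ C N, simple_monoid N, unitary_extension f,
        forall k m, rep k m -> p k = f m
      & forall k k', rep_cong rep k k' -> p k = p k'].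
Proof.
move=> [iotaP addP funP unitP conP cofP ordP].
have cM : conical M by case: hC CM => [->|[->|->]] => // -[].
have [||||N [p [psurj pP]]] := @congruence_quotient K (rep_cong rep).
- by [].
- by move=> x y xy g m; rewrite xy.
- by move=> x y z xy yz g m; rewrite xy.
- by move=> x y z xy g m; rewrite -!addrA.
(* [iota 0] may differ from 0; unitarity gives 0 some value, and uniqueness of values makes it 0. *)
have rep0 : rep 0 0.
  have [|m m0] := unitP (iota 0) 0 0 0 (iotaP 0); first by rewrite addr0.
  have := addP _ _ _ _ (iotaP 0) m0; rewrite addr0 add0r =>
    /(funP _ _ _ (iotaP 0)) m_eq0.
  by rewrite -m_eq0 in m0.
have pE k m : p k = p (iota m) <-> rep k m.
  rewrite pP; split=> [/(_ 0 m)|km].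
    by rewrite !addr0 => ->.
  have half x y g m' : rep x m -> rep y m -> rep (x + g) m' -> rep (y + g) m'.
    move=> xm ym xgm'; have [m'' gm''] := unitP _ _ _ _ xm xgm'.
    by rewrite (funP _ _ _ xgm' (addP _ _ _ _ xm gm'')); apply: addP.
  by move=> g m'; split; apply: half.
pose f0 m := p (iota m).
have f_morph : nmod_morphism f0.
  split=> [|x y]; first by rewrite -(raddf0 p); apply/esym/pE.
  by rewrite /f0 -raddfD; apply/esym/pE/addP.
pose fM := GRing.isNmodMorphism.Build M N f0 f_morph.
pose f : {additive M -> N} := HB.pack f0 fM.
have fE k m : p k = f m <-> rep k m by exact: pE.
have finj : injective f by move=> x y /fE; apply: funP.
have cN : conical N.
  move=> x y; have [h ->] := psurj x; have [k ->] := psurj y.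
  rewrite -raddfD -(raddf0 f) => /fE/conP[-> ->].
  by rewrite !raddf0.
have cof b : exists m z, b + z = f m.
  have [k ->] := psurj b; have [g [m kgm]] := cofP k.
  by exists m, (p g); rewrite -raddfD; apply/fE.
have uf : unitary_extension f.
  split=> // a0 a1 b; have [k ->] := psurj b.
  rewrite {1}/f /= /f0 -raddfD => /fE ka1.
  have [m km] := unitP _ _ _ _ (iotaP a0) ka1.
  by exists m; apply/fE.
have sepf (x y : N) : (forall z m, x + z = f m <-> y + z = f m) -> x = y.
  have [h ->] := psurj x; have [k ->] := psurj y => hk.
  by apply/pP => g m; rewrite -!fE !raddfD.
exists N, f, p; split=> //; last 2 first.
- by move=> k m /fE.
- by move=> k k' /pP.
- case: hC CM => [->|[->|->]] //= [_ CM]; split=> //.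
    exact: extension_cancellative sepf CM.
  apply: (extension_separative cN uf sepf).
  exact: separative_cancels.
(* Simplicity: a multiple of [k] lies above [k0'], whose value [m] is an order-unit of [M], and [M]
   is cofinal in [N]. *)
- move=> u u0; have [k uk] := psurj u.
  have k0 : k <> 0.
    by move=> k0; apply: u0; rewrite uk k0 raddf0; exists 0; rewrite addr0.
  have [n [k0' [k1 [m [n_gt0 kE k0m m0]]]]] := ordP _ k0.
  move=> x; have [y [z xz]] := cof x.
  have [n' [n'_gt0 [t yt]]] := order_unit_neq0 cM sM m0 y.
  exists (n * n')%N; split; first by rewrite muln_gt0 n_gt0.
  exists (z + f t + p k1 *+ n').
  have pk : p k *+ n = f m + p k1.
    by rewrite -raddfMn kE raddfD; congr (_ + _); apply/fE.
  by rewrite mulrnA uk pk mulrnDl !addrA xz -raddfD yt raddfMn.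
Qed.

Lemma closed_system (C : nmodType -> Prop) (M : nmodType)
    (hM : simply_unitarily_closed C M)
    (T : eqType) (L : seq T) (mk : T -> equation M) :
  (exists (N : nmodType) (f : {additive M -> N}),
     [/\ C N, simple_monoid N, unitary_extension f
       & exists x : nat -> N, {in L, forall t, eqn_holds f x (mk t)}]) ->
  exists x : nat -> M, {in L, forall t, eqn_holds idfun x (mk t)}.
Proof.
case: hM => _ _ clM [N [f [CN sN uf [x xP]]]].
have [|y yP] := clM _ (mk \o tnth (in_tuple L)).
  exists N, f; split=> //; exists x => j; apply: xP; exact: mem_tnth.
exists y => t tL; have /tnthP[i ->] : t \in in_tuple L by [].
exact: yP.
Qed.

(** * Adjoining a p-th part of an element *)

Lemma pair_mulrn (U V : nmodType) (x : U) (y : V) (n : nat) :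
  (x, y) *+ n = (x *+ n, y *+ n).
Proof. by elim: n => // n IHn; rewrite !mulrS IHn. Qed.

Lemma nat_mulrn (r n : nat) : r *+ n = (r * n)%N.
Proof. by elim: n => [|n IHn]; rewrite ?muln0 // mulrS mulnS IHn. Qed.

Lemma division_representation (M : nmodType) (cM : conical M)
    (a : M) (p : nat) : a <> 0 -> (0 < p)%N ->
  representation (K := (M * nat)%type) (fun m => (m, 0%N))
    (fun k m => exists2 q, k.2 = (q * p)%N & m = k.1 + a *+ q).
Proof.
move=> a0 p0; split=> /=.
- by move=> m; exists 0%N; rewrite // addr0.
- move=> k k' _ _ [q kq ->] [q' kq' ->]; exists (q + q')%N.
    by rewrite kq kq' mulnDl.
  by rewrite mulrnDr addrACA.
- move=> k m m' [q -> ->] [q' /eqP]; rewrite eqn_pmul2r // => /eqP ->.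
  by move=> ->.
- move=> k k' m m' [q kq _] [q' kq' _].
  exists (k'.1 + a *+ (q' - q)), (q' - q)%N => //.
  by rewrite mulnBl -kq' -kq /= addKn.
- move=> [x r] [x' r'] [q /= rq /esym/cM[/cM[-> ->]]] aq.
  have q0 : q = 0%N by exact: mulrn_eq0_nat aq.
  move: rq; rewrite q0 mul0n => /eqP; rewrite addn_eq0.
  by move=> /andP[/eqP-> /eqP->].
(* The added copies bring the second component to [r * p], a multiple of [p]. *)
- move=> [x r]; exists (0, (r * p.-1)%N), (x + a *+ r), r => /=.
    by rewrite -[LHS]/(r + r * p.-1)%N -mulnS prednK.
  by rewrite addr0.
- move=> [x r] xr0; exists p, ((x, r) *+ p), 0, (x *+ p + a *+ r).
  split=> //; rewrite ?addr0 //.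
    by rewrite pair_mulrn; exists r => //=; rewrite nat_mulrn.
  move=> /cM[/(mulrn_eq0_elt cM p0) x0]; case: r xr0 => [|r] xr0.
    by rewrite x0 in xr0.
  by move=> /(mulrn_eq0_elt cM (ltn0Sn _)).
Qed.

(** * Adjoining a common lower bound of two elements *)

Section LowerBound.

Variables (M : nmodType) (a b w : M) (n : nat).
Hypotheses (cM : conical M) (a0 : a <> 0) (b0 : b <> 0) (w0 : w <> 0).
Hypothesis n0 : (0 < n)%N.
Hypothesis bn : b *+ n = a + w.

(** [(x, (s, l))] stands for x + s d + l e; a value arises by grouping the unknowns into [i] copies
    of d + e, [j] of n d and [j'] of n e. *)
Definition lower_bound_rep (k : M * (nat * nat)) (m : M) : Prop :=
  exists i j j', [/\ k.2.1 = (i + n * j)%N, k.2.2 = (i + n * j')%N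
                   & m = k.1 + (b *+ i + a *+ j + w *+ j')].

Lemma lower_bound_representation :
  representation (fun m => (m, (0%N, 0%N))) lower_bound_rep.
Proof.
split.
- by move=> m; exists 0%N, 0%N, 0%N; rewrite muln0 !mulr0n !addr0.
- move=> [x [s l]] [x' [s' l']] ? ? [i [j [j' /= [-> -> ->]]]].
  move=> [i1 [j1 [j1' /= [-> -> ->]]]].
  exists (i + i1)%N, (j + j1)%N, (j' + j1')%N.
  rewrite !mulnDr !mulrnDr; split; try exact: addnACA.
  by do 2!(rewrite [LHS]addrACA; congr (_ + _)); exact: addrACA.
(* Two groupings differ by trading [n * t] copies of [b] for [t] copies of [a + w]. *)
- have half i j j' i1 j1 j1' : (i <= i1)%N ->
    (i + n * j = i1 + n * j1)%N -> (i + n * j' = i1 + n * j1')%N ->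
    b *+ i + a *+ j + w *+ j' = b *+ i1 + a *+ j1 + w *+ j1'.
    move=> ii1 ej ej'; pose t := (j - j1)%N.
    have jt : j = (t + j1)%N.
      by rewrite subnK // -(leq_pmul2l n0); lia.
    have it : i1 = (i + n * t)%N by move: ej; rewrite jt mulnDr; lia.
    have jt' : j' = (t + j1')%N.
      by apply/eqP; rewrite -(eqn_pmul2l n0); apply/eqP; rewrite mulnDr; lia.
    rewrite jt jt' it !mulrnDr mulrnA bn mulrnDl.
    by rewrite [LHS](AC (1*2*2) (((1*(2*4))*3)*5)).
  move=> [x [s l]] m m' [i [j [j' /= [-> -> ->]]]].
  move=> [i1 [j1 [j1' /= [ej ej' ->]]]].
  congr (_ + _); case: (leqP i i1) => [|/ltnW] ii1; first exact: half.
  by apply/esym/half.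
- move=> [x [s l]] [x' [s' l']] ? m' [i [j [j' /= [-> -> _]]]].
  move=> [i1 [j1 [j1' /= [ej ej' _]]]].
  (* So [s'] and [l'] agree modulo [n], and the smaller one counts the copies of [b]. *)
  have E : (s' + n * (j + j1') = l' + n * (j' + j1))%N.
    by move: ej ej'; rewrite !mulnDr -!/(addn _ _); lia.
  have half u v c d : (u <= v -> u + n * c = v + n * d ->
      v = u + n * (c - d))%N by rewrite mulnBr; lia.
  case: (leqP s' l') => [|/ltnW] sl; eexists.
    by exists s', 0%N, (j + j1' - (j' + j1))%N; split=> //=;
      [rewrite muln0 addn0 | apply: half].
  by exists l', (j' + j1 - (j + j1'))%N, 0%N; split=> //=;
    [apply: half | rewrite muln0 addn0].
- move=> [x [s l]] [x' [s' l']] [i [j [j' /= [es el]]]] /esym /cM[/cM[-> ->]].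
  move=> /cM[/cM[/(mulrn_eq0_nat cM b0) i0 /(mulrn_eq0_nat cM a0) j0]].
  move=> /(mulrn_eq0_nat cM w0) j0'.
  move: es el; rewrite i0 j0 j0' muln0 => /eqP + /eqP.
  by rewrite !addn_eq0 => /andP[/eqP-> /eqP->] /andP[/eqP-> /eqP->].
(* Adding the swapped counts makes both equal to [s + l]. *)
- move=> [x [s l]]; exists (0, (l, s)), (x + b *+ (s + l)).
  exists (s + l)%N, 0%N, 0%N; rewrite muln0 addn0 /= !addr0; split=> //.
  exact: addnC.
- move=> [x [s l]] k0.
  exists n, ((x, (s, l)) *+ n), 0, (x *+ n + (a *+ s + w *+ l)); split=> //.
  + by rewrite addr0.
  + rewrite !pair_mulrn !nat_mulrn.
    by exists 0%N, s, l; rewrite /= ![(_ * n)%N]mulnC mulr0n add0r.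
  + move=> /cM[/(mulrn_eq0_elt cM n0) x0].
    move=> /cM[/(mulrn_eq0_nat cM a0) s0 /(mulrn_eq0_nat cM w0) l0].
    by apply: k0; rewrite x0 s0 l0.
Qed.

End LowerBound.

(** * Adjoining a refinement matrix *)

Section RefinementExtension.

Variables (M : nmodType) (v al0 al1 be0 be1 : M).
Hypotheses (cM : conical M) (v0 : v <> 0).
Hypotheses (al0_neq0 : al0 <> 0) (al1_neq0 : al1 <> 0).
Hypotheses (be0_neq0 : be0 <> 0) (be1_neq0 : be1 <> 0).
Hypothesis sum_al_be : al0 + al1 = be0 + be1.

Let mat := ((nat * nat) * (nat * nat))%type.

(** Balance singles out the count matrices that are sums of full rows and full columns, as [mat_of]
    writes them. *)
Let bal (A : mat) : bool := (A.1.1 + A.2.2 == A.1.2 + A.2.1)%N.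

(* An unbalanced formal sum of the unknowns is only allowed together with a
   summand [v]: this is what makes the extension simple. *)
Definition refinement_dom : {pred M * mat} :=
  fun k => bal k.2 || `[< alg_le v k.1 >].

Let dom_closed : GRing.addr_closed refinement_dom.
Proof.
split=> // -[x [[p q] [r s]]] [x' [[p' q'] [r' s']]] /orP[bk|/asboolP[z /= <-]].
  move=> /orP[bk'|/asboolP[z /= <-]]; apply/orP.
    left; move: bk bk' => /eqP /= bk /eqP /= bk'; apply/eqP => /=.
    by change (p + p' + (s + s') = q + q' + (r + r'))%N; lia.
  by right; apply/asboolP; exists (x + z); rewrite /= addrCA.
by move=> _; apply/orP; right; apply/asboolP; exists (z + x'); rewrite /= addrA.
Qed.

Record refinement_monoid := RefinementMonoid {
  formal_sum :> M * mat;
  formal_sumP : refinement_dom formal_sum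
}.

HB.instance Definition _ := [isSub for formal_sum].
HB.instance Definition _ := [Choice of refinement_monoid by <:].
HB.instance Definition _ := GRing.SubChoice_isSubNmodule.Build
  (M * mat)%type refinement_dom refinement_monoid dom_closed.

Let dom_bal (m : M) (A : mat) : bal A -> refinement_dom (m, A).
Proof. by move=> bA; apply/orP; left. Qed.

Let dom_v (m : M) (A : mat) : refinement_dom (v + m, A).
Proof. by apply/orP; right; apply/asboolP; exists m. Qed.

Let mat_of (i0 i1 j0 j1 : nat) : mat :=
  (((i0 + j0)%N, (i0 + j1)%N), ((i1 + j0)%N, (i1 + j1)%N)).

Definition refinement_rep (k : refinement_monoid) (m : M) : Prop :=
  exists i0 i1 j0 j1, (val k).2 = mat_of i0 i1 j0 j1 /\
    m = (val k).1 + (al0 *+ i0 + al1 *+ i1 + (be0 *+ j0 + be1 *+ j1)).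

Let bal_mat_of (A : mat) : bal A -> exists i0 i1 j0 j1, A = mat_of i0 i1 j0 j1.
Proof.
(* Taking [i0] maximal leaves at most one nonzero column count; balance keeps the subtraction from
   [r] exact. *)
case: A => [[p q] [r s]] /eqP /= E; pose i0 := minn p q.
exists i0, (r - (p - i0))%N, (p - i0)%N, (q - i0)%N.
by congr ((_, _), (_, _)); rewrite /i0; lia.
Qed.

Let mat_of_bal i0 i1 j0 j1 : bal (mat_of i0 i1 j0 j1).
Proof. by apply/eqP; rewrite /=; lia. Qed.

Let mat_of_value i0 i1 j0 j1 i0' i1' j0' j1' :
  mat_of i0 i1 j0 j1 = mat_of i0' i1' j0' j1' ->
  al0 *+ i0 + al1 *+ i1 + (be0 *+ j0 + be1 *+ j1) =
  al0 *+ i0' + al1 *+ i1' + (be0 *+ j0' + be1 *+ j1').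
Proof.
wlog ii' : i0 i1 j0 j1 i0' i1' j0' j1' / (i0 <= i0')%N.
  move=> wl; case: (leqP i0 i0') => [|/ltnW] ii' E; first exact: wl.
  by apply/esym/wl.
(* Two decompositions differ by trading [t] times both columns for [t] times both rows, of equal
   total by [sum_al_be]. *)
move=> [e00 e01 e10 e11]; pose t := (i0' - i0)%N.
have -> : i0' = (i0 + t)%N by rewrite /t; lia.
have -> : i1' = (i1 + t)%N by rewrite /t; lia.
have -> : j0 = (t + j0')%N by rewrite /t; lia.
have -> : j1 = (t + j1')%N by rewrite /t; lia.
rewrite !mulrnDr [be0 *+ t + _ + _]addrACA -mulrnDl -sum_al_be mulrnDl.
by rewrite [LHS]addrA; congr (_ + _); exact: addrACA.
Qed.

Lemma refinement_representation :
  representation (fun m => RefinementMonoid (dom_bal m (mat_of_bal 0 0 0 0)))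
    refinement_rep.
Proof.
(* Proved first because it also shows below that a nonzero balanced element has a nonzero value. *)
have con k k' : refinement_rep (k + k') 0 -> k = 0 /\ k' = 0.
  move=> [i0 [i1 [j0 [j1 [kE /esym/cM[]]]]]].
  rewrite raddfD /= => /cM[kx kx'] /cM[].
  move=> /cM[/(mulrn_eq0_nat cM al0_neq0) i00].
  move=> /(mulrn_eq0_nat cM al1_neq0) i10.
  move=> /cM[/(mulrn_eq0_nat cM be0_neq0) j00].
  move=> /(mulrn_eq0_nat cM be1_neq0) j10.
  move: kE; rewrite raddfD /= i00 i10 j00 j10.
  move=> E; suff [kA kA'] : (val k).2 = 0 /\ (val k').2 = 0.
    by split; apply: val_inj; apply: injective_projections.
  move: E; case: (val k).2 (val k').2 => [[p q] [r s]] [[p' q'] [r' s']] /=.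
  move=> [/eqP + /eqP + /eqP + /eqP]; rewrite !addn_eq0.
  by do 4!(move=> /andP[/eqP-> /eqP->]).
split.
- move=> m; exists 0%N, 0%N, 0%N, 0%N; rewrite !mulr0n !addr0; split=> //.
- move=> k k' ? ? [i0 [i1 [j0 [j1 [kE ->]]]]] [i0' [i1' [j0' [j1' [kE' ->]]]]].
  exists (i0 + i0')%N, (i1 + i1')%N, (j0 + j0')%N, (j1 + j1')%N; split.
    rewrite raddfD /= kE kE'; congr ((_, _), (_, _)); exact: addnACA.
  rewrite raddfD !mulrnDr [LHS]addrACA; congr (_ + _).
  by rewrite [LHS]addrACA; congr (_ + _); exact: addrACA.
- move=> k m m' [i0 [i1 [j0 [j1 [kE ->]]]]] [i0' [i1' [j0' [j1' [kE' ->]]]]].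
  by congr (_ + _); apply: mat_of_value; rewrite -kE -kE'.
- move=> k k' m m' [i0 [i1 [j0 [j1 [kE _]]]]] [i0' [i1' [j0' [j1' [kE' _]]]]].
  have /bal_mat_of[i [i' [j [j' E]]]] : bal (val k').2.
    move: kE'; rewrite raddfD /= kE; case: (val k').2 => [[p q] [r s]] /= [].
    rewrite /bal /= => e1 e2 e3 e4; apply/eqP.
    by move: e1 e2 e3 e4; rewrite !natrDE /=; lia.
  by eexists; exists i, i', j, j'; split.
- exact: con.
- move=> k; case kE: (val k) => [x [[p q] [r s]]].
  (* Exchanging the columns makes each row of the sum constant, hence the sum balanced. *)
  pose g : refinement_monoid := RefinementMonoid (dom_v 0 ((q, p), (s, r))).
  have /bal_mat_of[i [i' [j [j' E]]]] : bal (val (k + g)).2.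
    rewrite raddfD /= kE; apply/eqP => /=.
    by change (p + q + (s + r) = q + p + (r + s))%N; lia.
  by exists g; eexists; exists i, i', j, j'; split.
- move=> k k0; case kE: (val k) (formal_sumP k) => [x A].
  move=> /orP[bA|/asboolP[y /= xE]].
    have [i [i' [j [j' E]]]] := bal_mat_of bA.
    have kr : refinement_rep k
        (x + (al0 *+ i + al1 *+ i' + (be0 *+ j + be1 *+ j'))).
      by exists i, i', j, j'; rewrite kE.
    exists 1%N, k, 0; eexists; split; first by [].
    + by rewrite addr0.
    + exact: kr.
    + by move=> m0; rewrite m0 -[k]addr0 in kr; have [/k0] := con _ _ kr.
  (* The double contains two copies of [v]: one is the element with a nonzero value, the other keeps
     the remainder in the domain. *)
  exists 2, (RefinementMonoid (dom_v 0 (mat_of 0 0 0 0))).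
  exists (RefinementMonoid (dom_v (y + y) (A *+ 2))), v; split=> //.
  + apply: val_inj; rewrite mulr2n !raddfD /= kE; congr (_, _) => //=.
    by rewrite addr0 -xE [LHS]addrACA -addrA.
  + exists 0%N, 0%N, 0%N, 0%N; split=> //.
    by rewrite !mulr0n !addr0.
Qed.

(** Each unknown is a matrix unit with the [v] that an unbalanced matrix requires, whence [v *+ 2]
    in every row and column sum. *)
Lemma refinement_extension :
  exists (K : nmodType) (iota : M -> K) (rep : K -> M -> Prop),
    representation iota rep /\ exists c00 c01 c10 c11,
    [/\ rep (c00 + c01) (al0 + v *+ 2), rep (c10 + c11) (al1 + v *+ 2),
        rep (c00 + c10) (be0 + v *+ 2) & rep (c01 + c11) (be1 + v *+ 2)].
Proof.
exists refinement_monoid; eexists; exists refinement_rep.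
split; first exact: refinement_representation.
pose c A : refinement_monoid := RefinementMonoid (dom_v 0 A).
exists (c ((1, 0), (0, 0)))%N, (c ((0, 1), (0, 0)))%N.
exists (c ((0, 0), (1, 0)))%N, (c ((0, 0), (0, 1)))%N.
split; [ exists 1%N, 0%N, 0%N, 0%N | exists 0%N, 1%N, 0%N, 0%N
       | exists 0%N, 0%N, 1%N, 0%N | exists 0%N, 0%N, 0%N, 1%N ];
  split=> //; by rewrite !mulr0n mulr1n !(addr0, add0r) /= !addr0 mulr2n addrC.
Qed.

End RefinementExtension.

(** * Divisibility and refinement in closed monoids *)

Section Closed.

Variable C : nmodType -> Prop.
Hypothesis hC : C = cone \/ C = cancellative_cone \/ C = separative_cone.
Variable M : nmodType.
Hypothesis hM : simply_unitarily_closed C M.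

Let CM : C M. Proof. by case: hM. Qed.
Let sM : simple_monoid M. Proof. by case: hM. Qed.
Let cM : conical M. Proof. by case: hC CM => [->|[->|->]] => // -[]. Qed.

Lemma closed_normally_divisible : normally_divisible M.
Proof.
move=> p X a p0; have [->|/eqP a0] := eqVneq a 0.
  by exists 0; rewrite mul0rn.
(* [None] stands for p u = a, [Some (x, y)] for a cancellation clause. *)
pose mk (t : option (M * M)) :=
  if t is Some (x, y)
  then @Equation M 1 (fun=> 1%N) (fun=> 1%N) x y
  else @Equation M 1 (fun=> p) (fun=> 0%N) 0 a.
pose L := None :: [seq Some t | t <- [seq (x, y) | x <- X, y <- X]
                   & t.1 + a == t.2 + a].
have [|u uP] := @closed_system C M hM _ L mk.
  have repM := division_representation cM a0 p0.
  have [N [f [i [CN sN uf iP cong]]]] := representation_extension hC CM sM repM.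
  exists N, f; split=> //; exists (fun=> i (0, 1%N)) => t.
  rewrite inE => /orP[/eqP->|/mapP[[x y]]].
    rewrite /eqn_holds /= !big_ord1 mulr0n raddf0 addr0 add0r.
    rewrite -raddfMn; apply: iP.
    exists 1%N; rewrite pair_mulrn /= ?mul0rn ?add0r //.
    by rewrite nat_mulrn !mul1n.
  rewrite mem_filter => /andP[/= /eqP xya _] ->.
  rewrite /eqn_holds /= !big_ord1 !mulr1n.
  have fE z : f z = i (z, 0%N).
    by apply/esym/iP; exists 0%N; rewrite // addr0.
  rewrite !fE -!raddfD; apply: cong => -[z s] m.
  (* The adjoined element has count 1, so a translate of it with a value involves at least one copy
     of [a], which absorbs the difference of [x] and [y]. *)
  have half (x' y' : M) : x' + a = y' + a ->
      forall q, ((0 + x' + z) + a *+ q.+1) = ((0 + y' + z) + a *+ q.+1).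
    move=> xya' q; rewrite !add0r mulrS [LHS](AC (2*2) ((1*3)*(2*4))).
    by rewrite [RHS](AC (2*2) ((1*3)*(2*4))) /= xya'.
  by split=> -[[|q] /= sq ->] //; exists q.+1 => //; apply: half.
exists (u 0%N); split.
  have := uP None (mem_head _ _).
  by rewrite /eqn_holds /= !big_ord1 mulr0n addr0 add0r.
move=> x y xX yX xya; have := uP (Some (x, y)).
rewrite /eqn_holds /= !big_ord1 !mulr1n ![u 0%N + _]addrC; apply.
rewrite inE /= mem_map; last by move=> ? ? [].
by rewrite mem_filter /= xya eqxx; apply/allpairsP; exists (x, y).
Qed.

Lemma closed_lower_bound (a b : M) : a <> 0 -> b <> 0 ->
  exists d, [/\ d <> 0, alg_le d a & alg_le d b].
Proof.
move=> a0 b0; have [n [_ [z azn]]] := order_unit_neq0 cM sM b0 a.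
(* A further summand [b] makes the remainder nonzero and the multiple positive. *)
have w0 : z + b <> 0 by move=> /cM[].
have bn : b *+ n.+1 = a + (z + b) by rewrite mulrSr -azn addrA.
pose mk (t : bool) :=
  if t then @Equation M 1 (fun=> n.+1) (fun=> 0%N) 0 a
  else @Equation M 2 (fun=> 1%N) (fun=> 0%N) 0 b.
have [|x xP] := @closed_system C M hM _ [:: true; false] mk.
  have repM := lower_bound_representation cM a0 b0 w0 (ltn0Sn n) bn.
  have [N [f [i [CN sN uf iP _]]]] := representation_extension hC CM sM repM.
  exists N, f; split=> //.
  exists (fun j => if j is 0%N then i (0, (1%N, 0%N)) else i (0, (0%N, 1%N))).
  case=> _; rewrite /eqn_holds /= ?big_ord1 ?big_ord_recl ?big_ord0 /=;
    rewrite ?mulr0n ?raddf0 ?addr0 ?add0r ?mulr1n.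
    rewrite -raddfMn; apply: iP.
    exists 0%N, 1%N, 0%N; rewrite !pair_mulrn !nat_mulrn /=.
    by rewrite mul1n mul0n muln0 muln1 !mulr0n mul0rn !add0r addr0.
  rewrite -raddfD; apply: iP.
  by exists 1%N, 0%N, 0%N; rewrite muln0 !mulr0n !addr0 /= !add0r.
have := xP true isT; have := xP false isT.
rewrite /eqn_holds /= ?big_ord1 !big_ord_recl !big_ord0 /=.
rewrite !mulr0n !mulr1n !addr0 !add0r => xb xa.
exists (x 0%N); split.
- by move=> x0; apply: a0; rewrite -xa x0 mul0rn.
- by exists (x 0%N *+ n); rewrite -mulrS.
- by exists (x 1%N).
Qed.

Lemma refinement_of_entries (a b : 'I_2 -> M) (c00 c01 c10 c11 : M) :
  a 0 = c00 + c01 -> a 1 = c10 + c11 -> b 0 = c00 + c10 -> b 1 = c01 + c11 ->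
  exists c : 'I_2 -> 'I_2 -> M,
    forall i, a i = c i 0 + c i 1 /\ b i = c 0 i + c 1 i.
Proof.
move=> a0 a1 b0 b1.
exists (fun i j => if i == 0 then if j == 0 then c00 else c01
                   else if j == 0 then c10 else c11) => i.
have [->|->] : i = 0 \/ i = 1; last by [].
  by case: i => [[|[|//]]] ?; [left | right]; apply: val_inj.
by [].
Qed.

Lemma closed_four_lower_bound (a b c d : M) :
  a <> 0 -> b <> 0 -> c <> 0 -> d <> 0 ->
  exists e, [/\ e <> 0, alg_le e a, alg_le e b, alg_le e c & alg_le e d].
Proof.
move=> a0 b0 c0 d0.
have [e1 [e1_neq0 [xa <-] [xb <-]]] := closed_lower_bound a0 b0.
have [e2 [e2_neq0 [xc <-] [xd <-]]] := closed_lower_bound c0 d0.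
have [e [e0 [x1 <-] [x2 <-]]] := closed_lower_bound e1_neq0 e2_neq0.
by exists e; split=> //; eexists; rewrite -addrA.
Qed.

Lemma closed_refinement_neq0 (a0 a1 b0 b1 : M) :
  a0 <> 0 -> a1 <> 0 -> b0 <> 0 -> b1 <> 0 -> a0 + a1 = b0 + b1 ->
  exists c00 c01 c10 c11 : M,
    [/\ a0 = c00 + c01, a1 = c10 + c11, b0 = c00 + c10 & b1 = c01 + c11].
Proof.
move=> a0_neq0 a1_neq0 b0_neq0 b1_neq0 ab.
have [d [d0 [xa0 Ea0] [xa1 Ea1] [xb0 Eb0] [xb1 Eb1]]] :=
  closed_four_lower_bound a0_neq0 a1_neq0 b0_neq0 b1_neq0.
(* Each of the four terms is d + x with d = 5v. Replacing one of the two [d] on each side by [v]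
   leaves 6v, so 3v for each term; the other 2v of each term come back through the refinement
   matrix. *)
pose X := [:: xa0 + xa1 + d; xb0 + xb1 + d].
have [v [vd Xv]] := @closed_normally_divisible 5 X d isT.
have xab : xa0 + xa1 + d + v = xb0 + xb1 + d + v.
  apply: Xv; rewrite ?inE ?eqxx ?orbT //.
  have shuffle (x y : M) : x + y + d + d = d + x + (d + y).
    by rewrite [RHS](AC (2*2) ((2*4)*1*3)).
  by rewrite !shuffle Ea0 Ea1 Eb0 Eb1.
have v0 : v <> 0 by move=> v0; apply: d0; rewrite -vd v0 mul0rn.
have nz (x : M) : x + v *+ 3 <> 0.
  by move=> /cM[_ /(mulrn_eq0_elt cM (ltn0Sn _))].
have sumE : xa0 + v *+ 3 + (xa1 + v *+ 3) = xb0 + v *+ 3 + (xb1 + v *+ 3).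
  have E6 (x y : M) : x + v *+ 3 + (y + v *+ 3) = x + y + d + v.
    by rewrite addrACA -mulrnDr -[RHS]addrA -vd -mulrSr.
  by rewrite !E6 xab.
have splitE (x : M) : d + x = x + v *+ 3 + v *+ 2.
  by rewrite -[RHS]addrA -mulrnDr vd addrC.
have [K [iota [rep [repM [k00 [k01 [k10 [k11 [r0 r1 c0 c1]]]]]]]]] :=
  refinement_extension cM v0 (nz xa0) (nz xa1) (nz xb0) (nz xb1) sumE.
(* [(u, w, m)] encodes x_u + x_w = m, with indicator functions as coefficients. *)
pose mk (t : nat * nat * M) :=
  @Equation M 4 (fun i => (i == t.1.1 :> nat) + (i == t.1.2 :> nat))%N
    (fun=> 0%N) 0 t.2.
have mkE (N : nmodType) (f : {additive M -> N}) (x : nat -> N) u w m :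
    (u < 4)%N -> (w < 4)%N ->
    eqn_holds f x (mk (u, w, m)) <-> x u + x w = f m.
  move=> u4 w4; rewrite /eqn_holds /= raddf0 addr0.
  rewrite [X in _ = X + _]big1 => [|i _]; last by rewrite mulr0n.
  rewrite add0r; under eq_bigr do rewrite mulrnDr.
  rewrite big_split /= (bigD1 (Ordinal u4)) //= big1 => [|i iu]; last first.
    by rewrite (_ : (i == u :> nat) = false) //; apply/negbTE.
  rewrite (bigD1 (Ordinal w4)) //= big1 => [|i iw]; last first.
    by rewrite (_ : (i == w :> nat) = false) //; apply/negbTE.
  by rewrite !eqxx !mulr1n !addr0.
have [|x xP] := @closed_system C M hM _
    [:: (0, 1, a0); (2, 3, a1); (0, 2, b0); (1, 3, b1)]%N mk.
  have [N [f [i [CN sN uf iP _]]]] := representation_extension hC CM sM repM.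
  exists N, f; split=> //; exists (nth 0 [:: i k00; i k01; i k10; i k11]) => t.
  by rewrite !inE => /or4P[] /eqP->; apply/mkE => //=; rewrite -raddfD;
    apply: iP; rewrite -?Ea0 -?Ea1 -?Eb0 -?Eb1 splitE.
exists (x 0%N), (x 1%N), (x 2%N), (x 3%N).
by split; apply/esym; apply/(mkE M idfun x) => //; apply: xP;
  rewrite !inE eqxx ?orbT.
Qed.

(** A zero term admits an explicit matrix; the rest is [closed_refinement_neq0]. *)
Lemma closed_refinement : refinement_property M.
Proof.
move=> a b ab.
have [a0|/eqP a0] := eqVneq (a 0) 0.
  apply: (@refinement_of_entries a b 0 0 (b 0) (b 1)); rewrite ?add0r //.
  by rewrite -ab a0 add0r.
have [a1|/eqP a1] := eqVneq (a 1) 0.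
  apply: (@refinement_of_entries a b (b 0) (b 1) 0 0); rewrite ?addr0 //.
  by rewrite -ab a1 addr0.
have [b0|/eqP b0] := eqVneq (b 0) 0.
  apply: (@refinement_of_entries a b 0 (a 0) 0 (a 1)); rewrite ?add0r //.
  by rewrite ab b0 add0r.
have [b1|/eqP b1] := eqVneq (b 1) 0.
  apply: (@refinement_of_entries a b (a 0) 0 (a 1) 0); rewrite ?addr0 //.
  by rewrite ab b1 addr0.
have [c00 [c01 [c10 [c11 []]]]] := closed_refinement_neq0 a0 a1 b0 b1 ab.
exact: refinement_of_entries.
Qed.

End Closed.

Theorem theorem2p6 (C : nmodType -> Prop)
    (hC : C = cone \/ C = cancellative_cone \/ C = separative_cone)
    (M : nmodType) (hM : simply_unitarily_closed C M) :
  normally_divisible M /\ refinement_cone M.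
Proof.
split; first exact: closed_normally_divisible hC _ hM.
split; last exact: closed_refinement hC _ hM.
by case: hM => CM _ _; case: hC CM => [->|[->|->]] // -[].
Qed.
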